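(* Every compact (without boundary) self-shrinker of the mean curvature flow in the 3-dimensional Euclidean space $\mathbb{R}^3$ is unstable, where stability is taken with respect to the weight $f(x)=|x|^2/4$.
   Context: A self-shrinker of the mean curvature flow is an oriented immersed surface $x:\Sigma\to\mathbb{R}^3$ such that $H=-\frac12\langle x,N\rangle$, where $N$ is a unit normal vector field on $\Sigma$, $A$ is the second fundamental form (shape operator $AX=-\overline\nabla_XN$) and $H=\mathrm{tr}\,A$. Consider $\mathbb{R}^3$ with the function $f(x)=\frac{|x|^2}{4}$; a self-shrinker is then a surface with weighted mean curvature $H_f=H+\langle N,\nabla f\rangle=0$. Let $\mathrm{Ric}_f=\mathrm{Ric}+\mathrm{Hess}\,f$, let $dv_f=e^{-f}dv$ be the weighted area element of $\Sigma$ ($dv$ the area element), and let $\Delta_fu=\Delta u-\langle\nabla u,\nabla f\rangle$ on $\Sigma$. The weighted Jacobi operator is $J_fu=\Delta_fu+(|A|^2+\mathrm{Ric}_f(N,N))u$ for $u\in C^\infty(\Sigma)$, where $|A|$ is the Hilbert–Schmidt norm. Its first eigenvalue is $\lambda_1=\inf\left\{\frac{-\int_\Sigma uJ_fu\,dv_f}{\int_\Sigma u^2\,dv_f}: u\in C^\infty(\Sigma),\ u\ne0\right\}$. The surface $\Sigma$ is called stable if $\lambda_1\ge0$, and unstable otherwise. *)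

(* Defs.v *)
From HB Require Import structures.
From mathcomp Require Import all_boot all_order all_algebra.
From mathcomp Require Import all_classical all_reals all_analysis.

Set Implicit Arguments.
Unset Strict Implicit.
Unset Printing Implicit Defensive.

Import Order.TTheory GRing.Theory Num.Theory.
Import numFieldNormedType.Exports.

Local Open Scope classical_set_scope.
Local Open Scope ring_scope.

Section Smooth.
Context {R : realType} {V W : normedModType R}.

(* f is C^n on the open set U: f is Frechet differentiable on U and every
   directional derivative is C^(n-1).  For finite-dimensional V this is the
   usual notion.  Values of f outside U are irrelevant because U is open. *)
Fixpoint Ck (n : nat) (U : set V) (f : V -> W) : Prop :=
  if n is m.+1 then
    (forall y, U y -> differentiable f y) /\ forall v, Ck m U ('D_v f)
  else forall y, U y -> {for y, continuous f}.

Definition smooth_on (U : set V) (f : V -> W) : Prop := forall n, Ck n U f.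

End Smooth.

(* The normed module 'rV[R]_3 carries the sup norm: it has the right topology
   and derivatives, but lengths and angles are taken with respect to dot. *)
Definition dot {R : realType} (v w : 'rV[R]_3) : R := \sum_k v ord0 k * w ord0 k.

Section Ambient.
Context {R : realType}.
Local Notation R3 := ('rV[R]_3).

Definition nabla3 (v : R3) (Y : R3 -> R3) : R3 -> R3 := 'D_v Y.

(* R(u,v)w; u, v, w are extended to constant fields, so that [u,v] = 0. *)
Definition curvature3 (u v w p : R3) : R3 :=
  nabla3 u (nabla3 v (cst w)) p - nabla3 v (nabla3 u (cst w)) p.

Definition ricci3 (p v w : R3) : R :=
  \sum_(k < 3) dot (curvature3 (delta_mx ord0 k) v w p) (delta_mx ord0 k).

Definition hessian3 (h : R3 -> R) (p v w : R3) : R := 'D_v ('D_w h) p.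

Definition weight (p : R3) : R := dot p p / 4.

Definition ricci_f (p v w : R3) : R := ricci3 p v w + hessian3 weight p v w.

End Ambient.

Section Chart.
Context {R : realType}.

Definition e2 (a : 'I_2) : R * R := if a == ord0 then (1, 0) else (0, 1).

Definition jacobian_det (h : R * R -> R * R) (y : R * R) : R :=
  ('D_(e2 ord0) h y).1 * ('D_(e2 ord_max) h y).2 -
  ('D_(e2 ord0) h y).2 * ('D_(e2 ord_max) h y).1.

(* coord and param are total functions, meaningful only on dom and
   coord @` dom respectively. *)
Record chart (T : ptopologicalType) := Chart {
  dom : set T;
  coord : T -> R * R;
  param : R * R -> T;
  dom_open : open dom;
  codom_open : open (coord @` dom);
  coordK : forall p, dom p -> param (coord p) = p;
  coord_cont : forall p, dom p -> {for p, continuous coord};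
  param_cont : forall y, (coord @` dom) y -> {for y, continuous param} }.

End Chart.
Arguments chart : clear implicits.

(* A nonempty (T is pointed) oriented smooth surface without boundary, given by
   an oriented atlas.
   chart_at only selects, for each point, a chart in which the pointwise
   (chart independent) geometric quantities below are computed. *)
Record surface (R : realType) (T : ptopologicalType) := Surface {
  index : Type;
  atlas : index -> chart R T;
  chart_at : T -> index;
  mem_chart_at : forall p, dom (atlas (chart_at p)) p;
  surface_hausdorff : hausdorff_space T;
  surface_countable : @second_countable T;
  transition_smooth : forall i j,
    smooth_on (coord (atlas i) @` (dom (atlas i) `&` dom (atlas j)))
      (coord (atlas j) \o param (atlas i));
  transition_oriented : forall i j y,
    (coord (atlas i) @` (dom (atlas i) `&` dom (atlas j))) y ->
    0 < jacobian_det (coord (atlas j) \o param (atlas i)) y }.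

Section Geometry.
Context {R : realType} {T : ptopologicalType} (S : surface R T).
Local Notation R3 := ('rV[R]_3).
Local Notation borelT := (g_sigma_algebraType (@open T)).

Definition codom (i : index S) : set (R * R) :=
  coord (atlas i) @` dom (atlas i).

Definition local {V : Type} (F : T -> V) (i : index S) : R * R -> V :=
  F \o param (atlas i).

Definition at_point {V : Type} (Q : index S -> R * R -> V) (p : T) : V :=
  Q (chart_at S p) (coord (atlas (chart_at S p)) p).

Definition smooth {V : normedModType R} (F : T -> V) : Prop :=
  forall i, smooth_on (codom i) (local F i).

Definition immersion (x : T -> R3) : Prop :=
  smooth x /\
  forall i y v, codom i y -> 'D_v (local x i) y = 0 -> v = 0.

Definition unit_normal (x N : T -> R3) : Prop :=
  [/\ smooth N, forall p, dot (N p) (N p) = 1 &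
      forall i y v, codom i y -> dot (local N i y) ('D_v (local x i) y) = 0].

Section FundamentalForms.
Variables x N : T -> R3.

Definition metric (i : index S) (y : R * R) : 'M[R]_2 :=
  \matrix_(a, b) dot ('D_(e2 a) (local x i) y) ('D_(e2 b) (local x i) y).

(* h_ab = <A x_a, x_b>, where A x_a = - D_a N. *)
Definition second_form (i : index S) (y : R * R) : 'M[R]_2 :=
  \matrix_(a, b) - dot ('D_(e2 a) (local N i) y) ('D_(e2 b) (local x i) y).

(* Matrix of A in the basis (x_1, x_2), with A x_a = \sum_b shape_ab x_b. *)
Definition shape (i : index S) (y : R * R) : 'M[R]_2 :=
  second_form i y *m invmx (metric i y).

Definition mean_curvature : T -> R := at_point (fun i y => \tr (shape i y)).

(* The metric trace of (v, w) |-> <A v, A w>. *)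
Definition shape_norm2 : T -> R := at_point (fun i y =>
  \tr (shape i y *m metric i y *m (shape i y)^T *m invmx (metric i y))).

Definition area_density (i : index S) (y : R * R) : R :=
  Num.sqrt (\det (metric i y)).

Definition grad_dot (u w : T -> R) : T -> R := at_point (fun i y =>
  \sum_a \sum_b invmx (metric i y) a b *
    'D_(e2 a) (local u i) y * 'D_(e2 b) (local w i) y).

Definition laplacian (u : T -> R) : T -> R := at_point (fun i y =>
  (area_density i y)^-1 *
  \sum_a 'D_(e2 a) (fun z => area_density i z *
    \sum_b invmx (metric i z) a b * 'D_(e2 b) (local u i) z) y).

Definition laplacian_f (u : T -> R) (p : T) : R :=
  laplacian u p - grad_dot u (weight \o x) p.

Definition jacobi_f (u : T -> R) (p : T) : R :=
  laplacian_f u p + (shape_norm2 p + ricci_f (x p) (N p) (N p)) * u p.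

Definition self_shrinker : Prop :=
  [/\ immersion x, unit_normal x N &
      forall p, mean_curvature p = - (1 / 2) * dot (x p) (N p)].

(* dv is the area element: in every chart dv = sqrt (det g) dy1 dy2.  Since
   countably many charts cover T, this determines dv. *)
Definition area_element (dv : {measure set borelT -> \bar R}) : Prop :=
  forall i (B : set borelT), measurable B -> B `<=` dom (atlas i) ->
    dv B = (\int[lebesgue_measure \x lebesgue_measure]_(y in
              (coord (atlas i) @` B : set (R * R))) (area_density i y)%:E)%E.

Section Eigenvalue.
Variable dv : {measure set borelT -> \bar R}.

Definition integral_f (h : T -> R) : R :=
  \int[dv]_(p in [set: borelT]) (h p * expR (- weight (x p))).

Definition rayleigh (u : T -> R) : R :=
  - integral_f (fun p => u p * jacobi_f u p) / integral_f (fun p => u p ^+ 2).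

Definition lambda1 : \bar R :=
  ereal_inf [set (rayleigh u)%:E | u in [set u : T -> R |
    smooth u /\ exists p, u p != 0]].

Definition stable : Prop := (0 <= lambda1)%E.
Definition unstable : Prop := ~ stable.

End Eigenvalue.
End FundamentalForms.
End Geometry.

(* Main.v *)
(* The constant function 1 destabilizes: since Hess f = 1/2 and R^3 is flat,
   J_f 1 = |A|^2 + 1/2 >= 1/2, so its Rayleigh quotient is negative as soon as
   the integrals involved are finite and nonzero.  Finiteness comes from
   compactness: |A|^2 is continuous because it does not depend on the chart, and
   the area of a coordinate ball is finite and positive. *)
Require Import Defs.
From mathcomp Require Import all_boot all_order all_algebra.
From mathcomp Require Import all_classical all_reals all_analysis.
From mathcomp Require Import ring.

(* Defs.index is otherwise shadowed by seq.index. *)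
Import Defs.

Import Order.TTheory GRing.Theory Num.Theory.
Import numFieldNormedType.Exports.
Set Implicit Arguments.
Unset Strict Implicit.
Unset Printing Implicit Defensive.

Local Open Scope classical_set_scope.
Local Open Scope ring_scope.

(** * Flatness of the ambient space and the Hessian of the weight *)

(** The curvature differentiates constant extensions of vectors, so every second derivative in it
    vanishes. *)
Lemma ricci3_eq0 (R : realType) (p v w : 'rV[R]_3) : ricci3 p v w = 0.
Proof.
rewrite /ricci3 big1// => k _.
rewrite /curvature3 /nabla3.
have D0 u z : 'D_u ('D_z (cst w)) p = 0 :> 'rV[R]_3.
  rewrite (_ : 'D_z _ = cst 0); first exact: derive_cst.
  by apply/funext => q; exact: derive_cst.
by rewrite !D0 subrr /dot big1// => i _; rewrite mxE mul0r.
Qed.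

Lemma derive_coord (R : realType) n (v p : 'rV[R]_n) k :
  is_derive p v (fun q : 'rV[R]_n => q ord0 k : R) (v ord0 k).
Proof.
apply: DeriveDef; first exact/diff_derivable/differentiable_coord.
have -> : v ord0 k = ('D_v id p) ord0 k by rewrite derive_id.
by rewrite derive_mx ?mxE//; exact: derivable_id.
Qed.

Lemma derive_dotr (R : realType) (v p w : 'rV[R]_3) :
  is_derive p v (fun q => dot q w) (dot v w).
Proof.
rewrite /dot.
rewrite (_ : (fun _ => _) = \sum_k (fun q : 'rV[R]_3 => q ord0 k * w ord0 k)).
  apply: is_derive_sum => k.
  have dk := derive_coord v p k; apply: is_derive_eq.
  by rewrite scaler0 add0r/= mulrC.
by apply/funext => q; rewrite fct_sumE.
Qed.

Lemma derive_weight (R : realType) (v p : 'rV[R]_3) :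
  is_derive p v weight (dot p v / 2).
Proof.
rewrite (_ : weight =
    \sum_k (fun q : 'rV[R]_3 => (1 / 4) *: (q ord0 k * q ord0 k))); last first.
  apply/funext => q; rewrite /weight /dot fct_sumE mulr_suml.
  by apply: eq_bigr => k _; rewrite /GRing.scale/= mul1r mulrC.
rewrite (_ : dot p v / 2 = \sum_k (1 / 4) *:
    (p ord0 k *: v ord0 k + p ord0 k *: v ord0 k)); last first.
  rewrite /dot mulr_suml; apply: eq_bigr => k _; rewrite /GRing.scale/=.
  by field.
apply: is_derive_sum => k; have dk := derive_coord v p k.
exact: (@is_deriveZ _ _ _ _ _ _ _ _ (is_deriveM dk dk)).
Qed.

Lemma hessian3_weight (R : realType) (p v w : 'rV[R]_3) :
  hessian3 weight p v w = dot v w / 2.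
Proof.
rewrite /hessian3.
rewrite (_ : 'D_w weight = (1 / 2) *: (fun q => dot q w)).
  have dp := derive_dotr v p w.
  by rewrite derive_val /GRing.scale/= mul1r mulrC.
apply/funext => q; have dq := derive_weight w q.
by rewrite derive_val /GRing.scale/= mul1r mulrC.
Qed.

Lemma ricci_f_unit (R : realType) (p v : 'rV[R]_3) :
  dot v v = 1 -> ricci_f p v v = 1 / 2.
Proof. by move=> v1; rewrite /ricci_f ricci3_eq0 hessian3_weight v1 add0r. Qed.

(** * Gram matrices and congruence of bilinear forms *)

Lemma det_mx2 (R : comRingType) (A : 'M[R]_2) :
  \det A = A ord0 ord0 * A ord_max ord_max - A ord0 ord_max * A ord_max ord0.
Proof.
rewrite (expand_det_row _ ord0) !big_ord_recl big_ord0 addr0 /cofactor.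
rewrite !det_mx11 !mxE /= expr0 expr1 mul1r mulN1r mulrN.
by congr (A _ _ * A _ _ - A _ _ * A _ _); apply/val_inj.
Qed.

Lemma adj_mx2 (R : comRingType) (A : 'M[R]_2) i j :
  (\adj A) i j = (-1) ^+ (j + i) * A (lift j ord0) (lift i ord0).
Proof. by rewrite mxE /cofactor det_mx11 !mxE. Qed.

Lemma trace_gram_ge0 (R : realFieldType) m n (A : 'M[R]_(m, n)) :
  0 <= \tr (A *m A^T).
Proof.
rewrite /mxtrace sumr_ge0// => i _; rewrite mxE sumr_ge0// => j _.
by rewrite mxE -expr2 sqr_ge0.
Qed.

(* For a singular Gram matrix, invmx returns the matrix itself. *)
Lemma invmx_gram (R : realFieldType) m n (G : 'M[R]_(m, n)) :
  exists K : 'M[R]_(m, n), invmx (G *m G^T) = K *m K^T.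
Proof.
have [gu|gNu] := boolP (G *m G^T \in unitmx); last first.
  by exists G; rewrite /invmx (negPf gNu).
(* Since [G *m G^T] is symmetric, so is its inverse, and [K *m K^T] collapses to that inverse. *)
exists (invmx (G *m G^T) *m G).
rewrite trmx_mul mulmxA -(mulmxA (invmx _)) mulVmx// mul1mx.
by rewrite trmx_inv trmx_mul trmxK.
Qed.

(** Once the inverse is written [K *m K^T], cyclicity of the trace gives the squared Frobenius norm
    of [K^T *m B *m G]. *)
Lemma trace_gram_form_ge0 (R : realFieldType) m n (G : 'M[R]_(m, n))
    (B : 'M[R]_m) :
  0 <= \tr (B *m (G *m G^T) *m B^T *m invmx (G *m G^T)).
Proof.
have [K ->] := invmx_gram G.
rewrite mulmxA mxtrace_mulC.
suff -> : K^T *m (B *m (G *m G^T) *m B^T *m K) =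
    (K^T *m B *m G) *m (K^T *m B *m G)^T by exact: trace_gram_ge0.
by rewrite !trmx_mul trmxK !mulmxA.
Qed.

Lemma invmx_congr (R : fieldType) n (J g : 'M[R]_n) :
  J \in unitmx -> g \in unitmx ->
  invmx (J *m g *m J^T) = (invmx J)^T *m invmx g *m invmx J.
Proof.
move=> Ju gu; have JTu : J^T \in unitmx by rewrite unitmx_tr.
have u : J *m g *m J^T \in unitmx by rewrite !unitmx_mul Ju gu JTu.
rewrite -[LHS]mulmx1.
suff <- : (J *m g *m J^T) *m ((invmx J)^T *m invmx g *m invmx J) = 1%:M.
  by rewrite mulKmx.
by rewrite trmx_inv !mulmxA mulmxK// mulmxK// mulmxV.
Qed.

(** With [g] the metric and [h] the second fundamental form, the trace is the squared norm of the
    shape operator. A change of basis conjugates [h *m invmx g] by [J]; the inner factors cancel in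
    pairs, the outer ones by cyclicity of the trace. *)
Lemma trace_form_change (R : fieldType) n (J g h : 'M[R]_n) :
  J \in unitmx -> g \in unitmx ->
  let norm2 g h := \tr (h *m invmx g *m g *m (h *m invmx g)^T *m invmx g) in
  norm2 (J *m g *m J^T) (J *m h *m J^T) = norm2 g h.
Proof.
move=> Ju gu /=; have JTu : J^T \in unitmx by rewrite unitmx_tr.
rewrite invmx_congr// !trmx_mul !trmxK trmx_inv !mulmxA.
rewrite !(mulmxK JTu, mulmxKV JTu, mulmxK Ju, mulmxKV Ju).
rewrite mxtrace_mulC !mulmxA mulVmx// mul1mx.
by rewrite !(mulmxK, mulmxKV)// ?trmx_inv !mulmxA ?(mulmxK JTu, mulmxKV JTu).
Qed.

Lemma dotC (R : realType) (a b : 'rV[R]_3) : dot a b = dot b a.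
Proof. by apply: eq_bigr => k _; rewrite mulrC. Qed.

Lemma sum_ord2 (V : nmodType) (f : 'I_2 -> V) :
  \sum_i f i = f ord0 + f ord_max.
Proof. by rewrite big_ord_recl big_ord1; congr (_ + f _); exact/val_inj. Qed.

Lemma det_gram2 (R : realType) (D : 'I_2 -> 'rV[R]_3) :
  let a := D ord0 in let b := D ord_max in
  \det (\matrix_(i, j) dot (D i) (D j)) = dot a a * dot b b - dot a b ^+ 2.
Proof. by rewrite det_mx2 !mxE (dotC (D ord_max)) -expr2. Qed.

(** [w] is [dot a a] times the component of [b] orthogonal to [a]. The identity links a degenerate
    Gram determinant to a vanishing combination of [a] and [b]. *)
Lemma dot_gram_schmidt (R : realType) (a b : 'rV[R]_3) :
  let w := - dot a b *: a + dot a a *: b in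
  dot w w = dot a a * (dot a a * dot b b - dot a b ^+ 2).
Proof.
have dotDr u v w : dot u (v + w) = dot u v + dot u w :> R.
  by rewrite /dot -big_split; apply: eq_bigr => k _; rewrite mxE mulrDr.
have dotZr c u v : dot u (c *: v) = c * dot u v :> R.
  by rewrite /dot mulr_sumr; apply: eq_bigr => k _; rewrite mxE mulrCA.
move=> w; rewrite dotDr !dotZr !(dotC w) !dotDr !dotZr (dotC b a).
by move: (dot a a) (dot a b) (dot b b) => aa ab bb; ring.
Qed.

(** * Tangent frames and their behaviour under a change of chart *)

Section Frame.
Context {R : realType} {T : ptopologicalType} (S : surface R T).
Implicit Types (F x N : T -> 'rV[R]_3) (i j : index S) (y : R * R).

(** Serves for both the immersion and the normal: the two fundamental forms become matrix products,
    and a chart change acts by left multiplication. *)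
Definition frame F i y : 'M[R]_(2, 3) :=
  \matrix_(a, k) ('D_(e2 a) (local F i) y) ord0 k.

Lemma metricE x i y : metric x i y = frame x i y *m (frame x i y)^T.
Proof.
by apply/matrixP => a b; rewrite !mxE; apply: eq_bigr => k _; rewrite !mxE.
Qed.

Lemma second_formE x N i y :
  second_form x N i y = - (frame N i y *m (frame x i y)^T).
Proof.
apply/matrixP => a b; rewrite !mxE; congr (- _).
by apply: eq_bigr => k _; rewrite !mxE.
Qed.

Lemma smooth_differentiable F i y :
  smooth S F -> codom i y -> differentiable (local F i) y.
Proof. by move=> /(_ i 1%N)[+ _] => /[apply]. Qed.

Lemma derive_e2E (V : normedModType R) (f : R * R -> V) y (v : R * R) :
  differentiable f y ->
  'D_v f y = v.1 *: 'D_(e2 ord0) f y + v.2 *: 'D_(e2 ord_max) f y.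
Proof.
move=> df; rewrite !deriveE// -!linearZ -linearD; congr ('d f y _).
case: v => a b; rewrite [RHS](_ : _ = (a * 1 + b * 0, a * 0 + b * 1))//.
by rewrite !(mulr1, mulr0) addr0 add0r.
Qed.

(** The codomain of chart [i] is open and [param (atlas i)] is continuous there, so points near the
    given one are still sent into the domain of chart [j]. *)
Lemma open_overlap i j :
  open (coord (atlas i) @` (dom (atlas i) `&` dom (atlas j))).
Proof.
rewrite openE => _ [p [pi pj] <-]; rewrite /interior.
have yi : codom i (coord (atlas i) p) by exists p.
have := open_nbhs_nbhs (conj (@codom_open _ _ (atlas i)) yi).
have : nbhs (coord (atlas i) p) (param (atlas i) @^-1` dom (atlas j)).
  apply: (param_cont yi); rewrite (coordK pi).
  exact: open_nbhs_nbhs (conj (@dom_open _ _ (atlas j)) pj).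
apply: filterS2 => z /= zj [q qi qz]; exists q => //; split => //.
by rewrite -(coordK qi) qz.
Qed.

Definition transition i j : R * R -> R * R := coord (atlas j) \o param (atlas i).

(** The transpose of the usual Jacobian matrix: rows are indexed by the direction of
    differentiation, as in [frame]. *)
Definition transition_mx i j y : 'M[R]_2 :=
  \matrix_(a, b) if b == ord0 then ('D_(e2 a) (transition i j) y).1
                 else ('D_(e2 a) (transition i j) y).2.

Lemma frame_transition F i j p : smooth S F ->
  dom (atlas i) p -> dom (atlas j) p ->
  frame F i (coord (atlas i) p) =
  transition_mx i j (coord (atlas i) p) *m frame F j (coord (atlas j) p).
Proof.
move=> sF pi pj; set y := coord (atlas i) p.
have oy : (coord (atlas i) @` (dom (atlas i) `&` dom (atlas j))) y by exists p.
have dt : differentiable (transition i j) y.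
  by have [+ _] := transition_smooth i j 1%N; exact.
have ty : transition i j y = coord (atlas j) p by rewrite /transition/= coordK.
have dF : differentiable (local F j) (transition i j y).
  by rewrite ty; apply: smooth_differentiable => //; exists p.
have E v : 'D_v (local F i) y =
    'D_('D_v (transition i j) y) (local F j) (coord (atlas j) p).
  (* The two local expressions agree only on the overlap; as it is open, they agree near [y] and the
     chain rule applies. *)
  rewrite (@near_eq_derive _ _ _ _ (local F j \o transition i j)).
    rewrite deriveE ?diff_comp//=; last exact: differentiable_comp.
    by rewrite -(deriveE _ dt) -ty (deriveE _ dF).
  have := open_nbhs_nbhs (conj (@open_overlap i j) oy).
  apply: filterS => _ [q [qi qj] <-].
  by rewrite /local /transition /= (coordK qi) (coordK qj).
apply/matrixP => a k; rewrite 2!mxE E derive_e2E; last by rewrite -ty.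
have frE b : frame F j (coord (atlas j) p) b k =
    ('D_(e2 b) (local F j) (coord (atlas j) p)) ord0 k by rewrite mxE.
have [J0 J1] : transition_mx i j y a ord0 = ('D_(e2 a) (transition i j) y).1 /\
    transition_mx i j y a ord_max = ('D_(e2 a) (transition i j) y).2.
  by split; rewrite mxE.
rewrite sum_ord2 !frE J0 J1.
by rewrite [LHS]mxE [X in X + _ = _]mxE [X in _ + X = _]mxE.
Qed.

Lemma transition_mx_unit i j p :
  dom (atlas i) p -> dom (atlas j) p ->
  transition_mx i j (coord (atlas i) p) \in unitmx.
Proof.
move=> pi pj; rewrite unitmxE unitfE det_mx2 !mxE/=.
have /gt_eqF/negbT : 0 < jacobian_det (transition i j) (coord (atlas i) p).
  by apply: transition_oriented; exists p.
by rewrite /jacobian_det.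
Qed.

(** If the determinant were nonpositive, the Gram-Schmidt combination of the coordinate vectors
    would have nonpositive square length, hence vanish. Injectivity of the differential then kills
    its coefficient [dot a a], which is positive. *)
Lemma det_metric_gt0 x i y : immersion S x -> codom i y -> 0 < \det (metric x i y).
Proof.
move=> [sx ix] iy.
have df := smooth_differentiable sx iy.
pose D c := 'D_(e2 c) (local x i) y; pose a := D ord0; pose b := D ord_max.
have dotvv0 (v : 'rV[R]_3) : dot v v <= 0 -> v = 0.
  move=> v0; apply/rowP => k; rewrite mxE; apply/eqP; rewrite -sqrf_eq0.
  rewrite eq_le sqr_ge0 andbT; apply: le_trans v0.
  rewrite /dot (bigD1 k)//= -expr2 lerDl sumr_ge0// => l _.
  by rewrite -expr2 sqr_ge0.
have a0 : 0 < dot a a.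
  rewrite ltNge; apply/negP => /dotvv0 /(ix _ _ _ iy) /(congr1 fst)/eqP.
  by rewrite /= oner_eq0.
have -> : \det (metric x i y) = dot a a * dot b b - dot a b ^+ 2.
  exact: (det_gram2 D).
rewrite ltNge; apply/negP => det0.
pose v : R * R := (- dot a b, dot a a).
have Dv : 'D_v (local x i) y = - dot a b *: a + dot a a *: b by rewrite derive_e2E.
have /dotvv0 : dot ('D_v (local x i) y) ('D_v (local x i) y) <= 0.
  rewrite (_ : dot _ _ = dot a a * (dot a a * dot b b - dot a b ^+ 2)).
    by rewrite pmulr_rle0.
  by rewrite Dv dot_gram_schmidt.
move=> /(ix _ _ _ iy)/(congr1 snd)/= a00.
by rewrite a00 ltxx in a0.
Qed.

(** The expression behind [shape_norm2], in an arbitrary chart instead of the one selected by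
    [chart_at]. *)
Definition chart_norm2 x N i y :=
  \tr (shape x N i y *m metric x i y *m (shape x N i y)^T *m invmx (metric x i y)).

Lemma chart_norm2_ge0 x N i y : 0 <= chart_norm2 x N i y.
Proof. rewrite /chart_norm2 metricE; exact: trace_gram_form_ge0. Qed.

(** By the chain rule for frames, both fundamental forms change by the same congruence, which leaves
    the trace invariant. *)
Lemma chart_norm2_transition x N i j p : immersion S x -> smooth S N ->
  dom (atlas i) p -> dom (atlas j) p ->
  chart_norm2 x N i (coord (atlas i) p) = chart_norm2 x N j (coord (atlas j) p).
Proof.
move=> ix sN pi pj; have [sx _] := ix.
set J := transition_mx i j (coord (atlas i) p).
have gE : metric x i (coord (atlas i) p) =
    J *m metric x j (coord (atlas j) p) *m J^T.
  by rewrite !metricE (frame_transition sx pi pj) trmx_mul !mulmxA.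
have hE : second_form x N i (coord (atlas i) p) =
    J *m second_form x N j (coord (atlas j) p) *m J^T.
  rewrite !second_formE (frame_transition sx pi pj) (frame_transition sN pi pj).
  by rewrite trmx_mul mulmxN mulNmx !mulmxA.
rewrite /chart_norm2 /shape gE hE; apply: trace_form_change.
  exact: transition_mx_unit.
by rewrite unitmxE unitfE gt_eqF// det_metric_gt0//; exists p.
Qed.
End Frame.

(** * Continuity of matrix-valued functions *)

Section EntrywiseContinuity.
Context {K : realFieldType} {X : topologicalType} (p : X).

(** Stated entry by entry, so that matrix operations reduce to sums and products of scalar
    functions. *)
Definition mx_continuous m n (A : X -> 'M[K]_(m, n)) :=
  forall i j, {for p, continuous (fun q => A q i j)}.

Lemma continuous_sum_at n (f : 'I_n -> X -> K) :
  (forall i, {for p, continuous (f i)}) ->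
  {for p, continuous (fun q => \sum_i f i q)}.
Proof.
by move=> cf; apply: cvg_big => [|i _]; [exact: add_continuous|exact: cf].
Qed.

Lemma mx_continuous_mul m n l (A : X -> 'M[K]_(m, n)) (B : X -> 'M[K]_(n, l)) :
  mx_continuous A -> mx_continuous B -> mx_continuous (fun q => A q *m B q).
Proof.
move=> cA cB i j.
rewrite (_ : (fun _ => _) = fun q => \sum_k A q i k * B q k j); last first.
  by apply/funext => q; rewrite mxE.
by apply: continuous_sum_at => k; apply: cvgM; [exact: cA|exact: cB].
Qed.

Lemma mx_continuous_tr m n (A : X -> 'M[K]_(m, n)) :
  mx_continuous A -> mx_continuous (fun q => (A q)^T).
Proof.
move=> cA i j; rewrite (_ : (fun _ => _) = fun q => A q j i); first exact: cA.
by apply/funext => q; rewrite mxE.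
Qed.

Lemma mx_continuous_opp m n (A : X -> 'M[K]_(m, n)) :
  mx_continuous A -> mx_continuous (fun q => - A q).
Proof.
move=> cA i j; rewrite (_ : (fun _ => _) = fun q => - A q i j).
  by apply: cvgN; exact: cA.
by apply/funext => q; rewrite mxE.
Qed.

Lemma continuous_mxtrace n (A : X -> 'M[K]_n) :
  mx_continuous A -> {for p, continuous (fun q => \tr (A q))}.
Proof. by move=> cA; apply: continuous_sum_at => i; exact: cA. Qed.

Lemma continuous_det2 (A : X -> 'M[K]_2) :
  mx_continuous A -> {for p, continuous (fun q => \det (A q))}.
Proof.
move=> cA; rewrite (_ : (fun _ => _) = fun q => A q ord0 ord0 * A q ord_max ord_max
  - A q ord0 ord_max * A q ord_max ord0); last first.
  by apply/funext => q; rewrite det_mx2.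
by apply: cvgB; apply: cvgM; exact: cA.
Qed.

(** The adjugate formula describes [invmx] only where the determinant is nonzero. That condition
    persists near [p], and equality near [p] is enough for the limit. *)
Lemma mx_continuous_inv2 (A : X -> 'M[K]_2) :
  mx_continuous A -> \det (A p) != 0 -> mx_continuous (fun q => invmx (A q)).
Proof.
move=> cA det0 i j; have cdet := continuous_det2 cA.
have inv2 q : \det (A q) != 0 -> (invmx (A q)) i j =
    (\det (A q))^-1 * ((-1) ^+ (j + i) * A q (lift j ord0) (lift i ord0)).
  by move=> dq; rewrite /invmx unitmxE unitfE dq mxE adj_mx2.
change (invmx (A q) i j @[q --> p] --> invmx (A p) i j); rewrite inv2//.
have : (\det (A q))^-1 * ((-1) ^+ (j + i) * A q (lift j ord0) (lift i ord0))
   @[q --> p] -->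
   (\det (A p))^-1 * ((-1) ^+ (j + i) * A p (lift j ord0) (lift i ord0)).
  by apply: cvgM; [exact: cvgV|apply: cvgM; [exact: cvg_cst|exact: cA]].
apply: cvg_trans; apply: near_eq_cvg.
have : \forall q \near p, \det (A q) != 0 by exact: cvgr_neq0 _ cdet det0.
by apply: filterS => q /inv2 ->.
Qed.
End EntrywiseContinuity.

(** * Continuity of the geometric quantities on the surface *)

Section ChartContinuity.
Context {R : realType} {T : ptopologicalType} (S : surface R T).
Implicit Types (F x N : T -> 'rV[R]_3) (i j : index S) (y : R * R) (p : T).

Lemma mx_continuous_frame F i y : smooth S F -> codom i y ->
  mx_continuous y (frame F i).
Proof.
move=> sF iy a k.
rewrite (_ : (fun _ => _) =
    (fun M : 'rV[R]_3 => M ord0 k) \o 'D_(e2 a) (local F i)).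
  apply: continuous_comp; last exact: coord_continuous.
  (* Being [Ck] of order 1 includes continuity of every directional derivative. *)
  have [_ cD] := sF i 1%N; exact: (cD (e2 a) y iy).
by apply/funext => z; rewrite mxE.
Qed.

Lemma mx_continuous_metric x i y : smooth S x -> codom i y ->
  mx_continuous y (metric x i).
Proof.
move=> sx iy; rewrite (_ : metric x i = fun z => frame x i z *m (frame x i z)^T).
  by apply: mx_continuous_mul; [|apply: mx_continuous_tr];
    exact: mx_continuous_frame.
by apply/funext => z; rewrite metricE.
Qed.

Lemma continuous_area_density x i y : smooth S x -> codom i y ->
  {for y, continuous (area_density x i)}.
Proof.
move=> sx iy.
apply: (@continuous_comp _ _ _ (fun z => \det (metric x i z)) Num.sqrt).
  exact/continuous_det2/mx_continuous_metric.
exact: sqrt_continuous.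
Qed.

Lemma continuous_chart_norm2 x N i y : immersion S x -> smooth S N -> codom i y ->
  {for y, continuous (chart_norm2 x N i)}.
Proof.
move=> ix sN iy; have [sx _] := ix.
have cx := mx_continuous_frame sx iy; have cN := mx_continuous_frame sN iy.
have cg := mx_continuous_metric sx iy.
have cgV : mx_continuous y (fun z => invmx (metric x i z)).
  by apply: mx_continuous_inv2; rewrite // gt_eqF// det_metric_gt0.
have cS : mx_continuous y (shape x N i).
  apply: mx_continuous_mul => //.
  rewrite (_ : second_form x N i = fun z => - (frame N i z *m (frame x i z)^T)).
    apply: mx_continuous_opp; apply: mx_continuous_mul => //.
    exact: mx_continuous_tr.
  by apply/funext => z; rewrite second_formE.
apply: continuous_mxtrace; apply: mx_continuous_mul => //.
apply: mx_continuous_mul; last exact: mx_continuous_tr.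
exact: mx_continuous_mul.
Qed.

(** Chart [i] stays fixed while [q] varies. Its domain is open, so near [p] the map [f] is a
    composite of continuous maps. *)
Lemma continuous_in_chart (U : topologicalType) (f : T -> U) i (g : R * R -> U) p :
  dom (atlas i) p -> {for coord (atlas i) p, continuous g} ->
  (forall q, dom (atlas i) q -> f q = g (coord (atlas i) q)) ->
  {for p, continuous f}.
Proof.
move=> ip cg fg; change (f q @[q --> p] --> f p); rewrite fg//.
have : g (coord (atlas i) q) @[q --> p] --> g (coord (atlas i) p).
  exact: continuous_comp (coord_cont ip) cg.
apply: cvg_trans; apply: near_eq_cvg.
have := open_nbhs_nbhs (conj (@dom_open _ _ (atlas i)) ip).
by apply: filterS => q /fg.
Qed.

Lemma smooth_continuous (F : T -> 'rV[R]_3) : smooth S F -> continuous F.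
Proof.
move=> sF p; have ip := mem_chart_at S p.
apply: (continuous_in_chart (g := local F (chart_at S p)) ip) => [|q qi].
  by apply: (sF _ 0%N); exists p.
by rewrite /local/= coordK.
Qed.

(** The chart [chart_at S q] may jump as [q] approaches [p]; chart independence allows every nearby
    value to be computed in the chart selected at [p]. *)
Lemma continuous_shape_norm2 x N : immersion S x -> smooth S N ->
  continuous (shape_norm2 S x N).
Proof.
move=> ix sN p; have ip := mem_chart_at S p.
apply: (continuous_in_chart (g := chart_norm2 x N (chart_at S p)) ip) => [|q qi].
  by apply: continuous_chart_norm2 ix sN _; exists p.
exact: (chart_norm2_transition ix sN (mem_chart_at S q) qi).
Qed.
End ChartContinuity.

Lemma continuous_weight (R : realType) : continuous (@weight R).
Proof.
move=> p.
have ck k : {for p, continuous (fun q : 'rV[R]_3 => q ord0 k : R)}.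
  exact: coord_continuous.
have cd : {for p, continuous (fun q : 'rV[R]_3 => dot q q)}.
  by apply: continuous_sum_at => k; exact: (continuousM (ck k) (ck k)).
have c4 : {for p, continuous (fun=> 4^-1 : R)} by exact: cst_continuous.
exact: (continuousM cd c4).
Qed.

(* The integral of a nonnegative function is a supremum over simple functions
   below it, so, unlike in ge0_le_integral, no measurability is needed. *)
Lemma ge0_le_integral_nonmeas d (X : measurableType d) (R : realType)
    (mu : {measure set X -> \bar R}) (D : set X) (f g : X -> \bar R) :
  (forall p, D p -> 0 <= f p)%E -> (forall p, D p -> f p <= g p)%E ->
  (\int[mu]_(p in D) f p <= \int[mu]_(p in D) g p)%E.
Proof.
move=> f0 fg; have g0 p : D p -> (0 <= g p)%E.
  by move=> Dp; exact: le_trans (f0 p Dp) (fg p Dp).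
rewrite !ge0_integralE//; apply: le_ereal_sup => _ [h hf <-]; exists h => // p.
apply: le_trans (hf p) _; rewrite /patch; case: ifPn => //.
by rewrite inE; exact: fg.
Qed.

(** * Two-sided bounds for integrals, in general and over squares *)

Lemma integral_bounds d (X : measurableType d) (R : realType)
    (mu : {measure set X -> \bar R}) (D : set X) (f : X -> R) (m M : R) :
  measurable D -> 0 <= m -> (forall p, D p -> m <= f p <= M) ->
  (m%:E * mu D <= \int[mu]_(p in D) (f p)%:E <= M%:E * mu D)%E.
Proof.
move=> mD m0 mfM; rewrite -!integral_cst//; apply/andP; split.
  by apply: ge0_le_integral_nonmeas => p /mfM/andP[]; rewrite lee_fin.
apply: ge0_le_integral_nonmeas => p /mfM/andP[mf fM]; rewrite lee_fin//.
exact: le_trans mf.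
Qed.

Lemma ball_prod (R : realType) (y : R * R) (r : R) :
  ball y r = ball y.1 r `*` ball y.2 r.
Proof. by []. Qed.

Lemma measurable_ball2 (R : realType) (y : R * R) (r : R) :
  measurable (ball y r : set (R * R)).
Proof.
rewrite ball_prod.
by apply: measurableX; exact: measurable_realfun.measurable_ball.
Qed.

(** The product carries the sup norm: a ball is a square of side [r *+ 2], and its measure is a
    product of interval lengths. *)
Lemma lebesgue_measure_ball2 (R : realType) (y : R * R) (r : R) : 0 <= r ->
  (lebesgue_measure \x lebesgue_measure)%E (ball y r : set (R * R)) =
  ((r *+ 2) ^+ 2)%:E.
Proof.
move=> r0.
have mb (c : R) : measurable (ball c r).
  exact: measurable_realfun.measurable_ball.
have E := product_measure1E (@lebesgue_measure R) (@lebesgue_measure R)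
  (mb y.1) (mb y.2).
rewrite ball_prod E expr2 EFinM; congr (_ * _)%E; exact: lebesgue_measure_ball.
Qed.

Lemma integral_ball2_bounds (R : realType) (y : R * R) (r m M : R)
    (f : R * R -> R) :
  0 <= r -> 0 <= m -> (forall z, ball y r z -> m <= f z <= M) ->
  ((m * (r *+ 2) ^+ 2)%:E <=
   \int[lebesgue_measure \x lebesgue_measure]_(z in (ball y r : set (R * R)))
     (f z)%:E
   <= (M * (r *+ 2) ^+ 2)%:E)%E.
Proof.
move=> r0 m0 mfM.
pose mu : {measure set (measurableTypeR R * measurableTypeR R) -> \bar R} :=
  (lebesgue_measure \x lebesgue_measure)%E.
have E : mu (ball y r) = _ := lebesgue_measure_ball2 y r0.
have B := integral_bounds mu (measurable_ball2 y r) m0 mfM.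
by move: B; rewrite E !(EFinM _ (_ ^+ 2)).
Qed.

(** * Finiteness and positivity of the total area *)

Section Area.
Context {R : realType} {T : ptopologicalType} (S : surface R T).
Local Notation borelT := (g_sigma_algebraType (@open T)).
Context (x : T -> 'rV[R]_3) (dv : {measure set borelT -> \bar R}).
Context (ix : immersion S x) (areaE : area_element S x dv).

(** By continuity, the area density stays between [d / 2] and [d + 1] on a small coordinate ball
    around the image of [p], where [d] is its positive value at the centre. [U] is the part of the
    surface over that ball. *)
Lemma open_area_bounds (p : T) :
  exists U : set T, [/\ open U, U p & (0 < dv U < +oo)%E].
Proof.
set i := chart_at S p; set y := coord (atlas i) p.
have ip : dom (atlas i) p by exact: mem_chart_at.
have iy : codom i y by exists p.
have [sx _] := ix; set d := area_density x i y.
have d0 : 0 < d by rewrite sqrtr_gt0 det_metric_gt0.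
have cd : area_density x i z @[z --> y] --> d by exact: continuous_area_density.
have d2d : d / 2 < d by rewrite ltr_pdivrMr// ltr_pMr// ltr1n.
have dd1 : d < d + 1 by rewrite ltrDl.
have : \forall z \near y, codom i z /\ d / 2 <= area_density x i z <= d + 1.
  have n0 := open_nbhs_nbhs (conj (@codom_open _ _ (atlas i)) iy).
  have n1 : \forall z \near y, d / 2 < area_density x i z.
    exact: cvgr_gt cd _ d2d.
  have n2 : \forall z \near y, area_density x i z < d + 1.
    exact: cvgr_lt cd _ dd1.
  by apply: filterS3 n0 n1 n2 => z z0 z1 z2; split => //; rewrite !ltW.
move=> /nbhs_ballP[r /= r0 yr].
pose U := dom (atlas i) `&` coord (atlas i) @^-1` ball y r.
have oU : open U.
  rewrite openE => q [qi qr]; rewrite /interior; apply: filterI.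
    exact: open_nbhs_nbhs (conj (@dom_open _ _ (atlas i)) qi).
  by apply: (coord_cont qi); apply: open_nbhs_nbhs; split => //; exact: ball_open.
exists U; split => //; first by split => //; exact: ballxx.
(* The ball was chosen inside the codomain of the chart, so it is covered entirely. *)
have imU : coord (atlas i) @` U = ball y r.
  apply/seteqP; split => [_ [q [_ qr] <-]//|z zr].
  by have [[q qi qz] _] := yr z zr; exists q; rewrite /U /= ?qz.
have mU : measurable (U : set borelT) by exact: sub_sigma_algebra.
rewrite (areaE (i := i) mU); last by move=> q [].
rewrite imU.
have /andP[lo hi] := integral_ball2_bounds (ltW r0)
  (ltW (divr_gt0 d0 (ltr0n _ 2))) (fun z zr => (yr z zr).2).
rewrite (lt_le_trans _ lo)/= ?(le_lt_trans hi) ?ltry//.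
by rewrite lte_fin mulr_gt0 ?divr_gt0// exprn_gt0// pmulrn_lgt0.
Qed.

(** One set of positive area bounds the total from below; a finite subcover by sets of finite area
    bounds it from above. *)
Lemma area_fin_pos : compact [set: T] -> (0 < dv [set: T] < +oo)%E.
Proof.
move=> cT; have [U U_] := choice open_area_bounds.
have oU p : open (U p) by have [] := U_ p.
have mU p : measurable (U p : set borelT) by exact: sub_sigma_algebra.
apply/andP; split.
  have [_ _ /andP[+ _]] := U_ point; move=> /lt_le_trans; apply.
  by apply: le_measure; rewrite ?inE//; exact: measurableT.
move: cT; rewrite compact_cover => /(_ T [set: T] U (fun p _ => oU p)).
case=> [q _|D _]; first by exists q => //; have [] := U_ q.
rewrite /cover bigcup_fset; set V := \big[_/_]_(_ <- _) _ => TV.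
suff [_] : measurable (V : set borelT) /\ (dv V < +oo)%E.
  by apply: le_lt_trans; rewrite (_ : V = setT)//; apply/seteqP.
(* Measurability is carried along because subadditivity of the measure requires it at each union. *)
apply: (@big_ind _ (fun A : set borelT => measurable A /\ (dv A < +oo)%E))
  => [|A B [mA fA] [mB fB]|q _].
- by rewrite measure0; split.
- split; first exact: measurableU.
  by apply: le_lt_trans (measureU2 _ mA mB) _; exact: lte_add_pinfty.
- by split => //; have [_ _ /andP[]] := U_ q.
Qed.

End Area.

(** * The Jacobi operator on constant functions *)

Section Constant.
Context {R : realType} {T : ptopologicalType} (S : surface R T).
Implicit Types (x N : T -> 'rV[R]_3).

Lemma derive_cst_fun (V W : normedModType R) (c : W) (v : V) :
  'D_v (cst c : V -> W) = cst 0.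
Proof. by apply/funext => q; exact: derive_cst. Qed.

Lemma smooth_cst (W : normedModType R) (c : W) : smooth S (cst c : T -> W).
Proof.
move=> i n; rewrite (_ : local _ _ = cst c)//.
elim: n c => [|n IH] c /=; first by move=> y _; exact: cst_continuous.
by split=> [y _|v]; [exact: differentiable_cst|rewrite derive_cst_fun].
Qed.

Lemma laplacian_f_cst x (c : R) p : laplacian_f S x (cst c) p = 0.
Proof.
rewrite /laplacian_f /laplacian /grad_dot /at_point; set i := chart_at S p.
rewrite [X in _ - X]big1 => [|a _]; last first.
  rewrite big1// => b _.
  rewrite (_ : 'D_(e2 a) (local _ i) _ = 0); last exact: derive_cst.
  by rewrite mulr0 mul0r.
rewrite subr0 big1 ?mulr0// => a _.
(* The outer derivative calls for vanishing of the inner expression as a function of [z], not just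
   at the given point. *)
rewrite (_ : (fun z => _) = cst 0); first exact: derive_cst.
apply/funext => z; rewrite big1 ?mulr0// => b _.
by rewrite (_ : 'D_(e2 b) _ z = 0) ?mulr0//; exact: derive_cst.
Qed.

Lemma jacobi_f_cst1 x N p : dot (N p) (N p) = 1 ->
  jacobi_f S x N (cst 1) p = shape_norm2 S x N p + 1 / 2.
Proof.
by move=> N1; rewrite /jacobi_f laplacian_f_cst add0r mulr1 ricci_f_unit.
Qed.

End Constant.

(** * Boundedness by compactness, and instability *)

Lemma compact_ubound (R : realType) (T : ptopologicalType) (f : T -> R) :
  compact [set: T] -> continuous f -> exists M, forall p, f p <= M.
Proof.
move=> cT cf.
have [|p _ pM] := compact_EVT_max _ cT (continuous_subspaceT cf).
  by exists point.
by exists (f p) => q; apply: pM; rewrite inE.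
Qed.

Lemma weight_ge0 (R : realType) (v : 'rV[R]_3) : 0 <= weight v.
Proof. by rewrite divr_ge0// sumr_ge0// => k _; rewrite -expr2 sqr_ge0. Qed.

Theorem corollary1p3 (R : realType) (T : ptopologicalType) (S : surface R T)
    (x N : T -> 'rV[R]_3)
    (dv : {measure set (g_sigma_algebraType (@open T)) -> \bar R}) :
  compact [set: T] ->
  self_shrinker S x N -> area_element S x dv ->
  unstable S x N dv.
Proof.
move=> cT [ix [sN N1 _] _] areaE; have [sx _] := ix.
have /andP[dv0 dvy] := area_fin_pos ix areaE cT.
have [a dvE] : exists a : R, dv [set: T] = a%:E.
  by exists (fine (dv [set: T])); rewrite fineK// ge0_fin_numE// ltW.
have a0 : 0 < a by rewrite -lte_fin -dvE.
have cw : continuous (weight \o x).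
  move=> p; apply: continuous_comp; first exact: smooth_continuous.
  exact: continuous_weight.
have [W wW] := compact_ubound cT cw.
have [M normM] := compact_ubound cT (continuous_shape_norm2 ix sN).
(* Used for both the numerator and the denominator of the Rayleigh quotient. The factor
   [expR (- weight)] lies between [expR (- W)] and 1, as the weight is nonnegative and at most
   [W]. *)
have integral_gt0 (h : T -> R) (m C : R) : 0 < m -> (forall p, m <= h p <= C) ->
    0 < integral_f x dv h.
  move=> m0 hmC.
  have hwC p : m * expR (- W) <= h p * expR (- weight (x p)) <= C.
    have /andP[mh hC] := hmC p; apply/andP; split.
      by rewrite ler_pM ?(ltW m0) ?expR_ge0// ler_expR lerN2 wW.
    rewrite -[leRHS]mulr1 ler_pM ?expR_ge0 ?(le_trans (ltW m0))//.
    by rewrite -expR0 ler_expR oppr_le0 weight_ge0.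
  have mW : 0 < m * expR (- W) by rewrite mulr_gt0 ?expR_gt0.
  have /andP[lo hi] := integral_bounds dv measurableT (ltW mW) (fun p _ => hwC p).
  (* The real integral is [fine] of the extended one, and [fine] sends [+oo] to 0: positivity needs
     the upper bound as well as the lower one. *)
  rewrite /integral_f /Rintegral fine_gt0//.
  rewrite (lt_le_trans _ lo)/= ?(le_lt_trans hi)//.
    by rewrite dvE -EFinM ltry.
  by rewrite dvE -EFinM lte_fin mulr_gt0.
apply/negP; rewrite -ltNge.
apply: (@le_lt_trans _ _ (rayleigh S x N dv (cst 1))%:E).
  apply: ereal_inf_lbound; exists (cst 1) => //; split; first exact: smooth_cst.
  by exists point; rewrite oner_eq0.
rewrite lte_fin /rayleigh mulNr oppr_lt0 divr_gt0//.
  (* The lower bound 1/2 is the Ricci term alone; the upper one adds the maximum [M] of the squared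
     norm of the shape operator. *)
  apply: (integral_gt0 _ (1 / 2) (M + 1 / 2)) => [|p]; first by rewrite divr_gt0.
  rewrite [cst 1 p * _]mul1r jacobi_f_cst1 ?N1//.
  by rewrite lerDr lerD2r chart_norm2_ge0 normM.
by apply: (integral_gt0 _ 1 1) => // p; rewrite expr1n lexx.
Qed.
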